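(* Let $\mathbf a$ be a Turing degree. Then for every $n<\omega$, $$\Gamma^n(\downarrow\mathbf a)=\downarrow\mathbf a^{(n)},$$ and the least (under inclusion) fixed point of $\Gamma$ among Turing ideals containing $\downarrow\mathbf a$ exists and equals $$\operatorname{Arith}(\mathbf a)=\bigcup_{n<\omega}\downarrow\mathbf a^{(n)}.$$ The closure ordinal of the iteration of $\Gamma$ starting from $\downarrow\mathbf a$ is exactly $\omega$.
   Context: Let $\mathcal D_T$ be the poset of Turing degrees under Turing reducibility $\leq_T$, with join $\mathbf a\vee\mathbf b=\deg_T(A\oplus B)$ and Turing jump $\mathbf a\mapsto\mathbf a'$. Put $\mathbf a^{(0)}=\mathbf a$ and $\mathbf a^{(n+1)}=(\mathbf a^{(n)})'$. A Turing ideal is a nonempty subset $I\subseteq\mathcal D_T$ that is closed downward under $\leq_T$ and closed under $\vee$; $\operatorname{Idl}(\mathcal D_T)$ is the set of Turing ideals ordered by inclusion. For a degree $\mathbf a$, $\downarrow\mathbf a=\{\mathbf b:\mathbf b\leq_T\mathbf a\}$, and for a set $S$ of degrees, $\downarrow S=\{\mathbf b:\exists\mathbf s\in S\ (\mathbf b\leq_T\mathbf s)\}$. The operator $\Gamma:\operatorname{Idl}(\mathcal D_T)\to\operatorname{Idl}(\mathcal D_T)$ is $\Gamma(I)=\downarrow\{\mathbf a':\mathbf a\in I\}$. Iteration of an operator $\Theta$ from an ideal $I_0$: $I_{\alpha+1}=\Theta(I_\alpha)$, and $I_\lambda=\bigcup_{\alpha<\lambda}I_\alpha$ for limit ordinals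 $\lambda$. The closure ordinal is the least ordinal $\alpha$ with $\Theta(I_\alpha)=I_\alpha$. *)

(* Defs.v *)
From HB Require Import structures.
From Stdlib Require Cantor.
From mathcomp Require Import all_boot all_order generic_quotient.
From mathcomp Require Import all_classical wochoice.

Set Implicit Arguments.
Unset Strict Implicit.
Unset Printing Implicit Defensive.

Import Order.TTheory.

Local Open Scope classical_set_scope.
Local Open Scope quotient_scope.

(* Oracle computability.  Partial functions are unary; several arguments are  *)
(* passed through Cantor's pairing bijection nat * nat -> nat.                *)

Definition pr (x y : nat) : nat := Cantor.to_nat (x, y).
Definition pfst (n : nat) : nat := (Cantor.of_nat n).1.
Definition psnd (n : nat) : nat := (Cantor.of_nat n).2.

Inductive code : Type :=
  | Zero | Succ | Fst | Snd
  | Oracle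
  | Pair of code & code
  | Comp of code & code
  | Prec of code & code
  | Mu of code.

(* [eval A c x y]: the partial function phi_c^A is defined at x with value y. *)
(*   Comp c d : x |-> c (d x)                                                 *)
(*   Prec c d : <x, 0> |-> c x,  <x, n+1> |-> d <x, <n, Prec c d <x, n>>>     *)
(*   Mu c     : x |-> the least y with c <x, y> = 0, provided that c <x, m>   *)
(*              is defined for every m < y                                    *)
Fixpoint eval (A : set nat) (c : code) : nat -> nat -> Prop :=
  match c with
  | Zero => fun _ y => y = 0
  | Succ => fun x y => y = x.+1
  | Fst => fun x y => y = pfst x
  | Snd => fun x y => y = psnd x
  | Oracle => fun x y => y = (x \in A)
  | Pair c d => fun x y =>
      exists u v, [/\ eval A c x u, eval A d x v & y = pr u v]
  | Comp c d => fun x y => exists2 u, eval A d x u & eval A c u y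
  | Prec c d => fun x =>
      (fix rec (n : nat) : nat -> Prop :=
         match n with
         | 0 => fun y => eval A c (pfst x) y
         | m.+1 => fun y =>
             exists2 z, rec m z & eval A d (pr (pfst x) (pr m z)) y
         end) (psnd x)
  | Mu c => fun x y =>
      eval A c (pr x y) 0 /\
      forall m, (m < y)%N -> exists k, eval A c (pr x m) k.+1
  end.

(* A bijective Goedel numbering of codes. *)
Fixpoint gnum (c : code) : nat :=
  match c with
  | Zero => 0
  | Succ => 1
  | Fst => 2
  | Snd => 3
  | Oracle => 4
  | Pair c d => 4 * pr (gnum c) (gnum d) + 5
  | Comp c d => 4 * pr (gnum c) (gnum d) + 6
  | Prec c d => 4 * pr (gnum c) (gnum d) + 7
  | Mu c => 4 * gnum c + 8
  end%N.

(* The characteristic function of A is computable from B. *)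
Definition turing_le (A B : set nat) : Prop :=
  exists c, forall x, eval B c x (x \in A).

Definition set_jump (A : set nat) : set nat :=
  [set e | exists c, gnum c = e /\ exists y, eval A c e y].

Definition set_join (A B : set nat) : set nat :=
  [set n.*2 | n in A] `|` [set n.*2.+1 | n in B].

Lemma turing_le_refl A : turing_le A A.
Proof. by exists Oracle. Qed.

Fixpoint subst_oracle (d c : code) : code :=
  match c with
  | Oracle => d
  | Pair c1 c2 => Pair (subst_oracle d c1) (subst_oracle d c2)
  | Comp c1 c2 => Comp (subst_oracle d c1) (subst_oracle d c2)
  | Prec c1 c2 => Prec (subst_oracle d c1) (subst_oracle d c2)
  | Mu c1 => Mu (subst_oracle d c1)
  | _ => c
  end.

Lemma eval_subst_oracle A B d c x y :
    (forall x, eval B d x (x \in A)) ->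
  eval A c x y -> eval B (subst_oracle d c) x y.
Proof.
move=> dP; elim: c x y => //=.
- by move=> x y ->.
- move=> c IHc c' IHc' x y [u [v [cu cv ->]]].
  by exists u, v; split; [exact: IHc|exact: IHc'|].
- by move=> c IHc c' IHc' x y [u cu cv]; exists u; [exact: IHc'|exact: IHc].
- move=> c IHc c' IHc' x; elim: (psnd x) => [|m IHm] y; first exact: IHc.
  by move=> [z /IHm mz /IHc' zy]; exists z.
- move=> c IHc x y [c0 cS]; split; first exact: IHc.
  by move=> m /cS[k ck]; exists k; exact: IHc.
Qed.

Lemma turing_le_trans B A C : turing_le A B -> turing_le B C -> turing_le A C.
Proof.
move=> [c cP] [d dP]; exists (subst_oracle d c) => x.
exact: eval_subst_oracle (cP x).
Qed.

(* Turing degrees: the quotient of the subsets of nat by Turing equivalence.  *)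

Definition turing_equiv (A B : set nat) : bool :=
  `[< turing_le A B /\ turing_le B A >].

Lemma turing_equiv_refl : reflexive turing_equiv.
Proof. by move=> A; apply/asboolP; split; exact: turing_le_refl. Qed.

Lemma turing_equiv_sym : symmetric turing_equiv.
Proof. by move=> A B; apply: asbool_equiv_eq; split=> -[]. Qed.

Lemma turing_equiv_trans : transitive turing_equiv.
Proof.
move=> B A C /asboolP[AB BA] /asboolP[BC CB]; apply/asboolP.
by split; exact: (turing_le_trans (B := B)).
Qed.

Canonical turing_equiv_canonical :=
  EquivRel turing_equiv turing_equiv_refl turing_equiv_sym turing_equiv_trans.

Definition degree : Type := {eq_quot turing_equiv}.
HB.instance Definition _ := Choice.on degree.
HB.instance Definition _ := Quotient.on degree.
HB.instance Definition _ := EqQuotient.on degree.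

Definition deg_le (a b : degree) : bool := `[< turing_le (repr a) (repr b) >].

Lemma deg_le_refl : reflexive deg_le.
Proof. by move=> a; apply/asboolP; exact: turing_le_refl. Qed.

Lemma deg_le_anti : antisymmetric deg_le.
Proof.
move=> a b /andP[/asboolP ab /asboolP ba].
by rewrite -[a]reprK -[b]reprK; apply/eqmodP/asboolP.
Qed.

Lemma deg_le_trans : transitive deg_le.
Proof.
move=> b a c /asboolP ab /asboolP bc; apply/asboolP.
exact: turing_le_trans ab bc.
Qed.

Fact degree_display : Order.disp_t. Proof. exact: Order.Disp tt tt. Qed.

HB.instance Definition _ := Order.Le_isPOrder.Build degree_display degree
  deg_le_refl deg_le_anti deg_le_trans.

Lemma deg_leE (A B : set nat) :
  (\pi_degree A <= \pi_degree B)%O = `[< turing_le A B >].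
Proof.
have repr_equiv C : turing_equiv (repr (\pi_degree C)) C.
  by apply/eqmodP; rewrite reprK.
have /asboolP[rA Ar] := repr_equiv A; have /asboolP[rB Br] := repr_equiv B.
apply: asbool_equiv_eq; split=> AB.
- exact: turing_le_trans Ar (turing_le_trans AB rB).
- exact: turing_le_trans rA (turing_le_trans AB Br).
Qed.

(* These are the classes of the join and jump of representatives.  The choice  *)
(* is immaterial, since set_join and set_jump are monotone for turing_le.      *)
Definition djoin : degree -> degree -> degree := lift_op2 degree set_join.
Definition djump : degree -> degree := lift_op1 degree set_jump.

(* Ideals of degrees.  [down S] is the library's down-closure. *)

Definition turing_ideal (I : set degree) : Prop :=
  [/\ I !=set0,
      forall a b, I b -> (a <= b)%O -> I a &
      forall a b, I a -> I b -> I (djoin a b)].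

Definition principal (a : degree) : set degree := [set b | (b <= a)%O].

(* Written on arbitrary sets of degrees; it restricts to an operator on       *)
(* Turing ideals.                                                             *)
Definition Gamma (I : set degree) : set degree := down (djump @` I).

Definition Arith (a : degree) : set degree :=
  \bigcup_n principal (iter n djump a).

(* Transfinite iteration.  An ordinal is represented by a point alpha of a    *)
(* well-ordered type (W, R), namely as the order type of the points below     *)
(* alpha; an iteration is indexed by W.                                       *)
Section Iteration.
Variables (W : Type) (R : rel W).

Definition strictly_below (alpha : W) : set W :=
  [set beta | R beta alpha /\ beta <> alpha].

Definition is_successor (alpha beta : W) : Prop :=
  strictly_below alpha = [set gamma | R gamma beta].

Definition is_limit (alpha : W) : Prop :=
  strictly_below alpha !=set0 /\ forall beta, ~ is_successor alpha beta.

Definition order_type_omega (alpha : W) : Prop :=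
  exists f : nat -> W,
    (forall m n, R (f m) (f n) = (m <= n)%N) /\ range f = strictly_below alpha.

Variables (T : Type) (Theta : set T -> set T) (I0 : set T).

Record iteration (s : W -> set T) : Prop := {
  iteration_zero : forall alpha, strictly_below alpha = set0 -> s alpha = I0;
  iteration_succ : forall alpha beta,
    is_successor alpha beta -> s alpha = Theta (s beta);
  iteration_limit : forall alpha,
    is_limit alpha -> s alpha = \bigcup_(beta in strictly_below alpha) s beta
}.

Definition is_closure_ordinal (alpha : W) : Prop :=
  exists s, [/\ iteration s,
    Theta (s alpha) = s alpha &
    forall beta, strictly_below alpha beta -> Theta (s beta) <> s beta].

End Iteration.

(* Main.v *)
(* Oracle codes can be rewritten effectively: the index of [subst_oracle d c] *)
(* is computed from that of [c] by course-of-values recursion, so the jump is *)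
(* monotone; a diagonal code built with [Mu] shows that it is strictly        *)
(* increasing.  Hence Gamma moves each principal ideal strictly upwards, to   *)
(* the principal ideal of the jump, and the union of the resulting chain is   *)
(* its first fixed point.  In an arbitrary well-order, every iteration is     *)
(* forced to be the [n]-th principal ideal at the point of rank [n], and      *)
(* [Arith a] at the first point without finite rank, which is the first limit *)
(* and the unique point of order type omega.                                  *)
Require Import Defs.
From Stdlib Require Cantor.
From mathcomp Require Import all_boot all_order generic_quotient.
From mathcomp Require Import all_classical wochoice.
From mathcomp Require Import zify.

Import Order.POrderTheory.

Local Open Scope classical_set_scope.
Local Open Scope quotient_scope.

(** Monotonicity of the jump gives [Gamma_principal]: among the jumps of degrees below [a], that of
    [a] is the largest. Iterating yields the finite stages. Their union is fixed, since one more
    jump only leads to the next stage ([Gamma_Arith]), and any fixed set of degrees containing the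
    first stage absorbs all the others because [Gamma] is monotone ([Arith_least]). No finite stage
    is fixed, as the jump of a degree is never below it.

    The two facts about the jump are proved on codes: [turing_le_set_jump] by an effective
    translation of indices, [set_jump_not_turing_le] by diagonalisation. For the closure ordinal,
    [iteration_rank] and [iteration_first_unranked] determine every iteration up to the first point
    of infinite rank, and [closure_ordinalP] concludes. *)

Lemma pfst_pr x y : pfst (pr x y) = x.
Proof. by rewrite /pfst /pr Cantor.cancel_of_to. Qed.

Lemma psnd_pr x y : psnd (pr x y) = y.
Proof. by rewrite /psnd /pr Cantor.cancel_of_to. Qed.

Lemma pr_proj n : pr (pfst n) (psnd n) = n.
Proof. by rewrite /pr /pfst /psnd -surjective_pairing Cantor.cancel_to_of. Qed.

Lemma leq_add_pr x y : (x + y <= pr x y)%N.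
Proof. by have := Cantor.to_nat_non_decreasing x y; rewrite /pr; lia. Qed.

Lemma pr_inj x y x' y' : pr x y = pr x' y' -> x = x' /\ y = y'.
Proof. by move=> /Cantor.to_nat_inj [-> ->]. Qed.

Lemma eval_functional A c x y z : eval A c x y -> eval A c x z -> y = z.
Proof.
elim: c x y z => //=; try by move=> x y z -> ->.
- move=> c IHc d IHd x y z [u [v [cu dv ->]]] [u' [v' [cu' dv' ->]]].
  by rewrite (IHc _ _ _ cu cu') (IHd _ _ _ dv dv').
- move=> c IHc d IHd x y z [u du cu] [u' du' cu'].
  by move: cu'; rewrite -(IHd _ _ _ du du'); exact: IHc.
- move=> c IHc d IHd x; elim: (psnd x) => [|m IHm] y z; first exact: IHc.
  move=> [u mu du] [u' mu' du'].
  by move: du'; rewrite -(IHm _ _ mu mu'); exact: IHd.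
- move=> c IHc x y z [cy ltc] [cz ltc'].
  case: (ltngtP y z) => // [/ltc'[k]|/ltc[k]] ck.
  + by have := IHc _ _ _ cy ck.
  + by have := IHc _ _ _ cz ck.
Qed.

(** Membership in a jump concerns domains, so divergence has to be preserved too. The new direction
    rests on determinism: at [Oracle], the only value [d] can return is the characteristic one. *)
Lemma eval_subst_oracle_iff A B d c x y :
    (forall x, eval B d x (x \in A)) ->
  eval B (subst_oracle d c) x y <-> eval A c x y.
Proof.
move=> dP; split; last exact: eval_subst_oracle.
elim: c x y => //=.
- by move=> x y dy; exact: eval_functional dy (dP x).
- move=> c IHc c' IHc' x y [u [v [cu cv ->]]].
  by exists u, v; split; [exact: IHc|exact: IHc'|].
- by move=> c IHc c' IHc' x y [u cu cv]; exists u; [exact: IHc'|exact: IHc].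
- move=> c IHc c' IHc' x; elim: (psnd x) => [|m IHm] y; first exact: IHc.
  by move=> [z /IHm mz /IHc' zy]; exists z.
- move=> c IHc x y [c0 cS]; split; first exact: IHc.
  by move=> m /cS[k ck]; exists k; exact: IHc.
Qed.

(** * Total functions computable in an oracle *)

Definition computable (A : set nat) (f : nat -> nat) : Prop :=
  exists c, forall x, eval A c x (f x).

Section Computable.
Variable A : set nat.
Local Notation computable := (computable A).

Lemma eq_computable f g : f =1 g -> computable f -> computable g.
Proof. by move=> fg [c cP]; exists c => x; rewrite -fg. Qed.

Lemma computable_comp f g :
  computable f -> computable g -> computable (fun x => f (g x)).
Proof. by move=> [c cP] [d dP]; exists (Comp c d) => x; exists (g x). Qed.

Lemma computable_pr f g :
  computable f -> computable g -> computable (fun x => pr (f x) (g x)).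
Proof.
by move=> [c cP] [d dP]; exists (Pair c d) => x; exists (f x), (g x).
Qed.

Lemma computable_fst f : computable f -> computable (fun x => pfst (f x)).
Proof. by apply: computable_comp; exists Fst. Qed.

Lemma computable_snd f : computable f -> computable (fun x => psnd (f x)).
Proof. by apply: computable_comp; exists Snd. Qed.

Lemma computable_succ f : computable f -> computable (fun x => (f x).+1).
Proof. by apply: computable_comp; exists Succ. Qed.

Lemma computable_id : computable id.
Proof.
exists (Pair Fst Snd) => x; exists (pfst x), (psnd x).
by split=> //; rewrite pr_proj.
Qed.

Lemma computable_cst n : computable (fun=> n).
Proof. by elim: n => [|n /computable_succ//]; exists Zero. Qed.

Lemma computable_nat_rect f g n :
    computable f ->
    computable (fun t => g (pfst t) (pfst (psnd t)) (psnd (psnd t))) ->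
    computable n ->
  computable (fun x => nat_rect (fun=> nat) (f x) (g x) (n x)).
Proof.
move=> [c cP] [d dP] nP.
have [e eP] := computable_pr _ _ computable_id nP.
exists (Comp (Prec c d) e) => x; exists (pr x (n x)) => //=.
rewrite pfst_pr psnd_pr; elim: (n x) => [|m IHm] //=.
by exists (nat_rect (fun=> nat) (f x) (g x) m) => //;
  have := dP (pr x (pr m (nat_rect (fun=> nat) (f x) (g x) m)));
  rewrite !(pfst_pr, psnd_pr).
Qed.

Lemma computable_iter g f n :
    computable g -> computable f -> computable n ->
  computable (fun x => iter (n x) g (f x)).
Proof.
move=> gP fP nP; apply: (eq_computable
  (fun x => nat_rect (fun=> nat) (f x) (fun=> g) (n x))) => [x|].
  by elim: (n x) => //= m ->.
apply: (computable_nat_rect _ (fun _ _ => g)) => //.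
apply: (computable_comp g) => //.
by do 2 apply: computable_snd; exact: computable_id.
Qed.

Lemma computable_add f g :
  computable f -> computable g -> computable (fun x => f x + g x)%N.
Proof.
move=> fP gP; apply: (eq_computable (fun x => iter (g x) succn (f x))).
  by move=> x; rewrite iter_succn addnC.
by apply: computable_iter => //; exists Succ.
Qed.

Lemma computable_mull k f : computable f -> computable (fun x => k * f x)%N.
Proof.
move=> fP; elim: k => [|k IHk]; first exact: computable_cst.
apply: (eq_computable (fun x => f x + k * f x)%N) => [x|]; first by lia.
exact: computable_add.
Qed.

Lemma computable_pred f : computable f -> computable (fun x => (f x).-1).
Proof.
move=> fP.
apply: (eq_computable
  (fun x => nat_rect (fun=> nat) 0 (fun m _ => m) (f x))).
  by move=> x; case: (f x).
apply: (computable_nat_rect (fun=> 0) (fun _ m _ => m)) => //.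
- exact: computable_cst.
- by apply: computable_fst; apply: computable_snd; exact: computable_id.
Qed.

Lemma computable_sub f g :
  computable f -> computable g -> computable (fun x => f x - g x)%N.
Proof.
move=> fP gP; apply: (eq_computable (fun x => iter (g x) predn (f x))).
  by move=> x; rewrite iter_predn.
by apply: computable_iter => //; exact: computable_pred computable_id.
Qed.

Lemma computable_if_leq a b f g :
    computable a -> computable b -> computable f -> computable g ->
  computable (fun x => if (a x <= b x)%N then f x else g x).
Proof.
move=> aP bP fP gP.
apply: (eq_computable
  (fun x => nat_rect (fun=> nat) (f x) (fun _ _ => g x) (a x - b x))).
  by move=> x; rewrite /leq; case: (a x - b x).
apply: (computable_nat_rect _ (fun x _ _ => g x)) => //.
- by apply: (computable_comp g) => //; exact: computable_fst computable_id.
- exact: computable_sub.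
Qed.

Lemma computable_div d f :
  (0 < d)%N -> computable f -> computable (fun x => f x %/ d)%N.
Proof.
move=> d_gt0 fP.
(* Passing from [m] to [m.+1] raises the quotient [z] by one exactly when [m.+1] reaches the next
   multiple of [d]. *)
pose g (m z : nat) := if (d * z.+1 <= m.+1)%N then z.+1 else z.
apply: (eq_computable (fun x => nat_rect (fun=> nat) 0 g (f x))) => [x|].
  elim: (f x) => [|m /= ->]; first by rewrite div0n.
  have divE q n : (d * q <= n < d * q.+1)%N -> n %/ d = q.
    move=> /andP[qn nq]; apply/eqP.
    by rewrite eqn_leq -ltnS ltn_divLR // leq_divRL // !(mulnC _ d) qn nq.
  have := ltn_ceil m d_gt0; have := leq_trunc_div m d.
  rewrite /g !(mulnC _ d); move: (m %/ d)%N => z.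
  by move=> zm mz; apply/esym/divE; case: ifP; rewrite !mulnS in mz *; lia.
apply: (computable_nat_rect (fun=> 0) (fun _ => g)) => //.
  exact: computable_cst.
have fst_snd := computable_fst _ (computable_snd _ computable_id).
have snd_snd := computable_snd _ (computable_snd _ computable_id).
apply: computable_if_leq => //; last exact: computable_succ.
- by apply: computable_mull; exact: computable_succ.
- exact: computable_succ.
Qed.

Lemma computable_mod d f :
  (0 < d)%N -> computable f -> computable (fun x => f x %% d)%N.
Proof.
move=> d_gt0 fP.
apply: (eq_computable (fun x => f x - d * (f x %/ d)))%N => [x|].
  by rewrite {1}(divn_eq (f x) d); nia.
by apply: computable_sub => //; apply/computable_mull/computable_div.
Qed.

End Computable.

(** * Course-of-values recursion *)

(* The course of values [F 0 _, ..., F n.-1 _], coded as nested pairs with    *)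
(* the most recent value outermost.                                           *)
Fixpoint history (F : nat -> nat -> nat) (n : nat) : nat :=
  if n is m.+1 then pr (F m (history F m)) (history F m) else 0.

(** The outermost value of a history of length [n] is the one at [n.-1], so dropping [n - k.+1]
    values exposes the one at [k]. *)
Definition lookup (n h k : nat) : nat := pfst (iter (n - k.+1) psnd h).

Lemma lookup_history F n k :
  (k < n)%N -> lookup n (history F n) k = F k (history F k).
Proof.
rewrite /lookup; elim: n => // n IHn; rewrite ltnS leq_eqVlt.
move=> /predU1P[->|kn]; first by rewrite subnn /= pfst_pr.
by rewrite subSn // iterSr /= psnd_pr; exact: IHn.
Qed.

Lemma computable_lookup A n h k :
    computable A n -> computable A h -> computable A k ->
  computable A (fun x => lookup (n x) (h x) (k x)).
Proof.
move=> nP hP kP; apply: computable_fst; apply: computable_iter => //.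
  exact: computable_snd (computable_id _).
by apply: computable_sub => //; exact: computable_succ.
Qed.

Lemma computable_course_of_values A F :
    computable A (fun t => F (pfst t) (psnd t)) ->
  computable A (fun n => F n (history F n)).
Proof.
(* The history is computed up to length [n.+1], so that its head is the value at [n]. *)
move=> FP; apply: (eq_computable A (fun n => pfst (nat_rect (fun=> nat) 0
    (fun m h => pr (F m h) h) n.+1))) => [n|].
  by rewrite /= pfst_pr; congr F; elim: n => //= n ->.
apply: computable_fst.
apply: (computable_nat_rect A (fun=> 0) (fun _ m h => pr (F m h) h) succn).
- exact: computable_cst.
- apply: computable_pr; last by do 2 apply: computable_snd; exact: computable_id.
  apply: (computable_comp A (fun t => F (pfst t) (psnd t)) psnd) => //.
  exact: computable_snd (computable_id _).
- exact: computable_succ (computable_id _).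
Qed.

(** * The numbering of codes and the effective substitution of oracles *)

Lemma gnum_inj : injective gnum.
Proof.
elim=> [|||||c IHc d IHd|c IHc d IHd|c IHc d IHd|c IHc]
  [|||||c' d'|c' d'|c' d'|c'] //= E; try lia.
- by have /pr_inj[/IHc-> /IHd->] : pr (gnum c) (gnum d) = pr (gnum c') (gnum d')
    by lia.
- by have /pr_inj[/IHc-> /IHd->] : pr (gnum c) (gnum d) = pr (gnum c') (gnum d')
    by lia.
- by have /pr_inj[/IHc-> /IHd->] : pr (gnum c) (gnum d) = pr (gnum c') (gnum d')
    by lia.
- by have /IHc-> : gnum c = gnum c' by lia.
Qed.

(** From 5 on, the remainder of [e - 5] modulo 4 selects the constructor and the quotient [q] holds
    the arguments; these are at most [q], hence smaller than the index. Thus reductions between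
    jumps never meet an invalid index. *)
Lemma gnum_surj e : exists c, gnum c = e.
Proof.
elim/ltn_ind: e => e IH.
case: e IH => [|[|[|[|[|e]]]]] IH; first by exists Zero.
- by exists Succ.
- by exists Fst.
- by exists Snd.
- by exists Oracle.
set q := (e %/ 4)%N; have ltq k : (k <= q)%N -> (k < e.+1.+4)%N by lia.
have := leq_add_pr (pfst q) (psnd q); rewrite pr_proj => leq.
have [|c cq] := IH (pfst q); first by lia.
have [|d dq] := IH (psnd q); first by lia.
have [|b bq] := IH q; first by lia.
have : (e %% 4 < 4)%N by rewrite ltn_mod.
case E: (e %% 4)%N => [|[|[|[|//]]]] _.
- by exists (Pair c d); rewrite /= cq dq pr_proj; lia.
- by exists (Comp c d); rewrite /= cq dq pr_proj; lia.
- by exists (Prec c d); rewrite /= cq dq pr_proj; lia.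
- by exists (Mu b); rewrite /= bq; lia.
Qed.

(* One step of the course-of-values recursion computing the map               *)
(* gnum c |-> gnum (subst_oracle d c): codes with arguments have number       *)
(* 4 q + r + 5, where r < 4 is the constructor and q codes the arguments.     *)
Definition subst_step (g n h : nat) : nat :=
  if (n <= 3)%N then n else if (n <= 4)%N then g else
  let q := ((n - 5) %/ 4)%N in let r := ((n - 5) %% 4)%N in
  (4 * (if (3 <= r)%N then lookup n h q
        else pr (lookup n h (pfst q)) (lookup n h (psnd q))) + (r + 5))%N.

Definition subst_index (d : code) (n : nat) : nat :=
  subst_step (gnum d) n (history (subst_step (gnum d)) n).

Lemma computable_subst_index A d : computable A (subst_index d).
Proof.
apply: computable_course_of_values; rewrite /subst_step.
have fstP := computable_fst A _ (computable_id A).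
have sndP := computable_snd A _ (computable_id A).
have cstP := computable_cst A.
have predP : computable A (fun t => pfst t - 5)%N by exact: computable_sub.
have divP : computable A (fun t => (pfst t - 5) %/ 4)%N
  by exact: computable_div.
have modP : computable A (fun t => (pfst t - 5) %% 4)%N
  by exact: computable_mod.
apply: computable_if_leq => //; apply: computable_if_leq => //.
apply: computable_add; last exact: computable_add.
apply/computable_mull/computable_if_leq => //; first exact: computable_lookup.
apply: computable_pr; apply: computable_lookup => //.
- exact: computable_fst.
- exact: computable_snd.
Qed.

Lemma subst_index_gnum d c :
  subst_index d (gnum c) = gnum (subst_oracle d c).
Proof.
have step r q : (r < 4)%N -> subst_index d (4 * q + (r + 5)) =
    (4 * (if (3 <= r)%N then subst_index d q
          else pr (subst_index d (pfst q)) (subst_index d (psnd q)))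
     + (r + 5))%N.
  move=> r4; rewrite {1}/subst_index {1}/subst_step.
  rewrite ifF; last by lia.
  rewrite ifF; last by lia.
  have -> : ((4 * q + (r + 5) - 5) %/ 4 = q)%N by lia.
  have -> : ((4 * q + (r + 5) - 5) %% 4 = r)%N by lia.
  have := leq_add_pr (pfst q) (psnd q); rewrite pr_proj => leq.
  by rewrite /= !lookup_history //; lia.
elim: c => //= [c IHc c' IHc'|c IHc c' IHc'|c IHc c' IHc'|c IHc].
- by rewrite (step 0) //= pfst_pr psnd_pr IHc IHc'.
- by rewrite (step 1) //= pfst_pr psnd_pr IHc IHc'.
- by rewrite (step 2) //= pfst_pr psnd_pr IHc IHc'.
- by rewrite (step 3) //= IHc.
Qed.

(** * The jump is monotone and strictly increasing *)

Fixpoint cst_code (n : nat) : code :=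
  if n is m.+1 then Comp Succ (cst_code m) else Zero.

Lemma eval_cst_code A n x y : eval A (cst_code n) x y <-> y = n.
Proof.
elim: n y => //= n IHn y; split=> [[u /IHn-> ->//]|->].
by exists n => //; exact/IHn.
Qed.

Lemma eval_comp_cst A c n x y :
  eval A (Comp c (cst_code n)) x y <-> eval A c n y.
Proof.
split=> /= [[u /eval_cst_code->//]|cy].
by exists n => //; exact/eval_cst_code.
Qed.

(** The instance of the s-m-n theorem needed here: for [f x = gnum c], the formula is the number of
    [Comp c (cst_code x)]. *)
Lemma computable_gnum_comp_cst A f :
    computable A f ->
  computable A (fun x => 4 * pr (f x) (gnum (cst_code x)) + 6)%N.
Proof.
move=> fP; apply: computable_add; last exact: computable_cst.
apply/computable_mull/computable_pr => //.
(* If [z] numbers a code, [g z] numbers its composition with [Succ], whose number is 1. *)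
pose g z := (4 * pr 1 z + 6)%N.
apply: (eq_computable A (fun x => iter x g 0)) => [x|].
  by elim: x => //= x ->.
apply: computable_iter; [|exact: computable_cst|exact: computable_id].
apply: computable_add; last exact: computable_cst.
apply/computable_mull/computable_pr; first exact: computable_cst.
exact: computable_id.
Qed.

(** Many-one reductions relative to [B] are Turing reductions. *)
Lemma turing_le_preimage A B f :
  computable B f -> (forall x, A x <-> B (f x)) -> turing_le A B.
Proof.
move=> [c cP] AB; exists (Comp Oracle c) => x; exists (f x) => //=.
by congr nat_of_bool; apply/idP/idP; rewrite !inE AB.
Qed.

Lemma set_jump_gnum A c : set_jump A (gnum c) <-> exists y, eval A c (gnum c) y.
Proof. by split=> [[d [/gnum_inj-> ?//]]|cy]; exists c. Qed.

(** The jump runs a code on its own index, and translating the oracle changes that index.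
    Precomposing the translated code with the constant [e] makes it ignore its input and run on the
    original index. *)
Lemma turing_le_set_jump A B :
  turing_le A B -> turing_le (set_jump A) (set_jump B).
Proof.
move=> [d dP].
pose f e := (4 * pr (subst_index d e) (gnum (cst_code e)) + 6)%N.
apply: (turing_le_preimage _ _ f) => [|e].
  by apply: computable_gnum_comp_cst; exact: computable_subst_index.
have [c <-] := gnum_surj e; rewrite /f subst_index_gnum.
rewrite -/(gnum (Comp _ _)) !set_jump_gnum.
split=> -[y cy]; exists y.
- exact/eval_comp_cst/(eval_subst_oracle_iff _ _ _ _ _ _ dP).
- exact/(eval_subst_oracle_iff _ _ _ _ _ _ dP)/eval_comp_cst/cy.
Qed.

(** An unbounded search whose test ignores the search variable: it stops at 0 if [f x = 0] and never
    otherwise. *)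
Lemma computable_zero_domain A f : computable A f ->
  exists c, forall x, (exists y, eval A c x y) <-> f x = 0.
Proof.
move=> fP; have [d dP] : computable A (fun t => f (pfst t)).
  by apply: computable_comp => //; exact: computable_fst (computable_id _).
exists (Mu d) => x; split=> /= [[y [d0 _]]|fx].
  by have := eval_functional _ _ _ _ _ (dP (pr x y)) d0; rewrite pfst_pr.
by exists 0; split=> //; have := dP (pr x 0); rewrite pfst_pr fx.
Qed.

Lemma turing_le_jump A : turing_le A (set_jump A).
Proof.
have [c cP] : exists c, forall x, (exists y, eval A c x y) <-> A x.
  have AP : computable A (fun x => 1 - (x \in A))%N.
    by apply: computable_sub; [exact: computable_cst|exists Oracle].
  have [c cP] := computable_zero_domain _ _ AP; exists c => x.
  by rewrite cP -[A x]in_setE; case: (x \in A); split.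
apply: (turing_le_preimage _ _
  (fun x => 4 * pr (gnum c) (gnum (cst_code x)) + 6)%N) => [|x].
  by apply: computable_gnum_comp_cst; exact: computable_cst.
rewrite -/(gnum (Comp _ _)) set_jump_gnum -cP.
by split=> -[y cy]; exists y; apply/eval_comp_cst; exact: cy.
Qed.

(** Otherwise some code [c] halts exactly on the complement of the jump; run on its own index, it
    halts if and only if it does not. *)
Lemma set_jump_not_turing_le A : ~ turing_le (set_jump A) A.
Proof.
move=> /computable_zero_domain[c cP]; have := set_jump_gnum A c.
rewrite cP -[set_jump A _]in_setE.
by case: (_ \in _) => -[// h1 h2]; [have := h1 isT|have := h2 erefl].
Qed.

Lemma turing_le_set_join A B C :
  turing_le A C -> turing_le B C -> turing_le (set_join A B) C.
Proof.
move=> AC BC.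
suff [c cP] : computable C (fun x => if (1 <= x %% 2)%N
    then nat_of_bool ((x %/ 2)%N \in B) else (x %/ 2)%N \in A).
  exists c => x; suff -> : x \in set_join A B =
      (if (1 <= x %% 2)%N then (x %/ 2)%N \in B else (x %/ 2)%N \in A).
    by have := cP x; case: ifP.
  apply/idP/idP; rewrite inE.
  - move=> [[n An]|[n Bn]] <-.
    + by rewrite ifF; [rewrite inE; have -> : (n.*2 %/ 2 = n)%N by lia|lia].
    + by rewrite ifT; [rewrite inE; have -> : (n.*2.+1 %/ 2 = n)%N by lia|lia].
  - case: ifP => x2; rewrite inE => h; [right|left];
      by exists (x %/ 2)%N => //; lia.
have divP : computable C (fun x => x %/ 2)%N.
  by apply: computable_div => //; exact: computable_id.
apply: computable_if_leq.
- exact: computable_cst.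
- by apply: computable_mod => //; exact: computable_id.
- exact: (computable_comp C (fun x => nat_of_bool (x \in B))).
- exact: (computable_comp C (fun x => nat_of_bool (x \in A))).
Qed.

(** * The jump on degrees and the operator [Gamma] *)

Lemma djumpE a : djump a = \pi_degree (set_jump (repr a)).
Proof. by rewrite /djump -lock. Qed.

Lemma djump_le a b : (a <= b)%O -> (djump a <= djump b)%O.
Proof.
move=> /asboolP ab; rewrite !djumpE deg_leE; apply/asboolP.
exact: turing_le_set_jump.
Qed.

Lemma le_djump a : (a <= djump a)%O.
Proof.
by rewrite -{1}[a]reprK djumpE deg_leE; apply/asboolP/turing_le_jump.
Qed.

Lemma djump_not_le a : ~ (djump a <= a)%O.
Proof.
rewrite -{2}[a]reprK djumpE deg_leE => /asboolP.
exact: set_jump_not_turing_le.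
Qed.

Lemma djoin_le a b c : (a <= c)%O -> (b <= c)%O -> (djoin a b <= c)%O.
Proof.
move=> /asboolP ac /asboolP bc; rewrite -[c]reprK /djoin -lock deg_leE.
by apply/asboolP; exact: turing_le_set_join.
Qed.

Lemma iter_djump_le a m n :
  (m <= n)%N -> (iter m djump a <= iter n djump a)%O.
Proof.
elim: n => [|n IHn]; first by rewrite leqn0 => /eqP->; exact: lexx.
rewrite leq_eqVlt => /predU1P[->|/IHn h]; first exact: lexx.
exact: le_trans h (le_djump _).
Qed.

Lemma principal_sub a b : principal a `<=` principal b <-> (a <= b)%O.
Proof.
split=> [|ab c ca]; first by apply; rewrite /principal /=.
exact: le_trans ca ab.
Qed.

Lemma Gamma_principal a : Gamma (principal a) = principal (djump a).
Proof.
apply/seteqP; split=> b.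
- move=> [_ [[c ca <-] bc]].
  by apply: le_trans bc _; exact: djump_le.
- move=> ba; exists (djump a); split=> //.
  by exists a => //; rewrite /principal /=.
Qed.

Lemma iter_Gamma_principal a n :
  iter n Gamma (principal a) = principal (iter n djump a).
Proof. by elim: n => //= n ->; rewrite Gamma_principal. Qed.

Lemma principal_not_fixed a : Gamma (principal a) <> principal a.
Proof.
rewrite Gamma_principal => E; apply: (djump_not_le a).
by apply/principal_sub; rewrite E.
Qed.

Lemma Gamma_Arith a : Gamma (Arith a) = Arith a.
Proof.
apply/seteqP; split=> b.
- move=> [_ [[c [n _ cn] <-] bc]]; exists n.+1 => //=.
  by apply: le_trans bc _; exact: djump_le.
- move=> [n _ bn]; exists (djump b); split; last exact: le_djump.
  by exists b => //; exists n.
Qed.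

Lemma Arith_ideal a : turing_ideal (Arith a).
Proof.
split.
- by exists a; exists 0 => //; rewrite /principal /=.
- move=> b c [n _ cn] bc; exists n => //.
  exact: le_trans bc cn.
- move=> b c [m _ bm] [n _ cn]; exists (maxn m n) => //.
  apply: djoin_le.
  + apply: le_trans bm _.
    exact: iter_djump_le (leq_maxl _ _).
  + apply: le_trans cn _.
    exact: iter_djump_le (leq_maxr _ _).
Qed.

Lemma Arith_least a (J : set degree) :
  principal a `<=` J -> Gamma J = J -> Arith a `<=` J.
Proof.
move=> aJ JG b [n _ bn].
have GJ (I : set degree) : I `<=` J -> Gamma I `<=` J.
  move=> IJ c [_ [[d Id <-] cd]]; rewrite -JG.
  by exists (djump d); split=> //; exists d => //; exact: IJ.
have: iter n Gamma (principal a) `<=` J by elim: n {bn} => //= n; exact: GJ.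
by rewrite iter_Gamma_principal; apply.
Qed.

(** * Iterations along an arbitrary well-order *)

Section WellOrder.
Variables (W : Type) (R : rel W).
Hypothesis wR : well_order R.

(** [well_order] asserts that nonempty sets have a unique minimum; the order axioms are recovered
    from it by considering sets of one, two or three points. *)
Lemma well_order_least (P : set W) :
  P !=set0 -> exists x, P x /\ forall y, P y -> R x y.
Proof.
move=> [x Px]; have [|z [[zP minz] _]] := wR (mem P).
  by exists x; rewrite inE.
exists z; split; first by move: zP; rewrite inE.
by move=> y Py; apply: minz; rewrite inE.
Qed.

Lemma well_order_refl x : R x x.
Proof.
by have [|y [-> h]] := well_order_least [set x]; [exists x|exact: h].
Qed.

Lemma well_order_total x y : R x y \/ R y x.
Proof.
have [|z [[]-> h]] := well_order_least [set x; y]; first by exists x; left.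
- by left; apply: h; right.
- by right; apply: h; left.
Qed.

Lemma well_order_anti x y : R x y -> R y x -> x = y.
Proof.
move=> xy yx; have [|z [_ zuniq]] := wR (mem [set x; y]).
  by exists x; rewrite inE; left.
rewrite -(zuniq x); last first.
  split; first by rewrite inE; left.
  by move=> t; rewrite inE => -[]->//; exact: well_order_refl.
rewrite -(zuniq y) //.
split; first by rewrite inE; right.
by move=> t; rewrite inE => -[]->//; exact: well_order_refl.
Qed.

Lemma well_order_trans x y z : R x y -> R y z -> R x z.
Proof.
move=> xy yz.
have [|t [tP h]] := well_order_least [set x; y; z]; first by exists x; left; left.
have hx := h x (or_introl (or_introl erefl)).
have hy := h y (or_introl (or_intror erefl)).
have hz := h z (or_intror erefl).
case: tP => [[]|] tE; rewrite {}tE // in hx hy hz *.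
- by rewrite (well_order_anti _ _ xy hx).
- by rewrite (well_order_anti _ _ yz hy) // in xy *.
Qed.

Lemma not_strictly_below x y : ~ strictly_below R x y -> R x y.
Proof.
move=> nyx; have [//|yx] := well_order_total x y.
have [->|yNx] := pselect (y = x); first exact: well_order_refl.
by case: nyx.
Qed.

Lemma strictly_below_le x y z : R x y -> strictly_below R x z ->
  strictly_below R y z.
Proof.
move=> xy [zx zNx]; split; first exact: well_order_trans zx xy.
by move=> zy; apply: zNx; apply: well_order_anti; rewrite // zy.
Qed.

Lemma is_successor_below x y : is_successor R x y -> strictly_below R x y.
Proof. by move=> ->; exact: well_order_refl. Qed.

Lemma strictly_below_inj x y : strictly_below R x = strictly_below R y -> x = y.
Proof.
wlog xy : x y / R x y => [hw|].
  by case: (well_order_total x y) => [|yx E]; [exact: hw|exact/esym/hw].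
move=> E; apply: contrapT => xNy.
by have : strictly_below R y x by []; rewrite -E => -[].
Qed.

(** In a well-order this says that exactly [n] points lie strictly below [x]; the form matches the
    zero and successor clauses of [iteration]. *)
Fixpoint has_rank (n : nat) (x : W) : Prop :=
  if n is m.+1 then exists2 y, has_rank m y & is_successor R x y
  else strictly_below R x = set0.

Lemma has_rank_inj n x y : has_rank n x -> has_rank n y -> x = y.
Proof.
elim: n x y => [|n IHn] x y /=.
  by move=> x0 y0; apply: strictly_below_inj; rewrite x0.
move=> [x' x'n xS] [y' y'n yS]; apply: strictly_below_inj.
by rewrite xS yS (IHn _ _ x'n y'n).
Qed.

Lemma has_rank_functional m n x : has_rank m x -> has_rank n x -> m = n.
Proof.
elim: m n x => [|m IHm] [|n] x //=.
- by move=> x0 [y _ /is_successor_below]; rewrite x0.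
- by move=> [y _ /is_successor_below] + x0; rewrite x0.
- move=> [y ym xy] [z zn xz]; congr S; apply: IHm ym _.
  suff -> : y = z by [].
  have yz : [set t | R t y] = [set t | R t z] by rewrite -xy -xz.
  apply: well_order_anti.
  + by have : [set t | R t y] y := well_order_refl y; rewrite yz.
  + by have : [set t | R t z] z := well_order_refl z; rewrite -yz.
Qed.

Lemma has_rank_below n x y :
  has_rank n x -> strictly_below R x y -> exists m, has_rank m y.
Proof.
elim: n x y => [|n IHn] x y /=; first by move=> ->.
move=> [z zn xS]; rewrite xS /= => yz.
have [->|yNz] := pselect (y = z); first by exists n.
exact: IHn zn _.
Qed.

(** The point that represents the ordinal omega, see [order_type_omegaP]. *)
Definition first_unranked (x : W) : Prop :=
  ~ (exists m, has_rank m x) /\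
  forall y, strictly_below R x y -> exists m, has_rank m y.

Lemma exists_first_unranked x : ~ (exists m, has_rank m x) ->
  exists y, first_unranked y /\ R y x.
Proof.
move=> xN.
have [|y [yN ymin]] := well_order_least [set y | ~ exists m, has_rank m y].
  by exists x.
exists y; split; last exact: ymin.
split=> // z [zy zNy]; apply: contrapT => /ymin yz.
by apply: zNy; exact: well_order_anti.
Qed.

Lemma exists_rank_below x n : first_unranked x ->
  exists2 y, strictly_below R x y & has_rank n y.
Proof.
move=> [xN xlt]; elim: n => [|n [y yx yn]].
  have [|y [_ ymin]] := well_order_least setT; first by exists x.
  have y0 : strictly_below R y = set0.
    by apply/seteqP; split=> // z [zy []]; apply: well_order_anti zy (ymin _ _).
  exists y => //; apply: contrapT => h; apply: xN; exists 0.
  by rewrite (well_order_anti x y) //; [exact: not_strictly_below|exact: ymin].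
(* The successor of [y] is the least point not below or equal to [y]. It stays strictly below [x],
   since otherwise [x] would be that successor and have rank [n.+1]. *)
have [|z [zP zmin]] := well_order_least [set z | ~ R z y].
  by exists x => xy; case: yx => yx; apply; exact: well_order_anti.
have zS : is_successor R z y.
  apply/seteqP; split=> t /=.
    move=> [tz tNz]; apply: contrapT => /zmin zt.
    by apply: tNz; exact: well_order_anti.
  move=> ty; split=> [|tz]; last by apply: zP; rewrite -tz.
  apply: well_order_trans ty _.
  by case: (well_order_total y z).
exists z; last by exists y.
apply: contrapT => /not_strictly_below xz; apply: xN; exists n.+1.
rewrite (well_order_anti x z) //; first by exists y.
by apply: zmin => xy; case: yx => yx; apply; exact: well_order_anti.
Qed.

(** An enumeration [f] of the points below [x] in order type omega must put the point of rank [n] at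
    position [n]; conversely, choosing the point of each rank below [x] gives such an
    enumeration. *)
Lemma order_type_omegaP x : order_type_omega R x <-> first_unranked x.
Proof.
split=> [[f [fR rf]]|xP].
  have fx n : strictly_below R x (f n) by rewrite -rf; exists n.
  have below n z : strictly_below R (f n) z -> exists2 m, (m < n)%N & z = f m.
    move=> zn; have : strictly_below R x z.
      exact: strictly_below_le (fx n).1 zn.
    rewrite -rf => -[m _ mz]; exists m => //; move: zn; rewrite -mz => -[].
    by rewrite fR leq_eqVlt => /predU1P[->|].
  have f_rank n : has_rank n (f n).
    elim: n => [|n IHn] /=.
      by apply/seteqP; split=> // z /below[].
    exists (f n) => //; apply/seteqP; split=> z /=.
      by move=> /below[m mn ->]; rewrite fR.
    move=> zn; split; first by apply: well_order_trans zn _; rewrite fR.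
    by move=> zE; move: zn; rewrite zE fR ltnn.
  split=> [[n xn]|y]; last by rewrite -rf => -[n _ <-]; exists n.
  by have [_] := fx n; apply; exact: has_rank_inj (f_rank n) xn.
have [f fP] := choice (fun n =>
  let: ex_intro2 y yx yn := exists_rank_below _ n xP in
  ex_intro (fun y => strictly_below R x y /\ has_rank n y) y (conj yx yn)).
have fS n : is_successor R (f n.+1) (f n).
  have [_ [y yn]] := fP n.+1.
  by rewrite (has_rank_inj _ _ _ yn (fP n).2).
have f_mono m n : (m <= n)%N -> R (f m) (f n).
  elim: n => [|n IHn]; first by rewrite leqn0 => /eqP->; exact: well_order_refl.
  rewrite leq_eqVlt => /predU1P[->|/IHn mn]; first exact: well_order_refl.
  exact: well_order_trans mn (is_successor_below _ _ (fS n)).1.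
exists f; split=> [m n|].
  apply/idP/idP; last exact: f_mono.
  apply: contraTT; rewrite -ltnNge => /f_mono nm; apply/negP => mn.
  have [nn] := is_successor_below _ _ (fS n); apply.
  by apply: well_order_anti nn _; exact: well_order_trans nm mn.
apply/seteqP; split=> [_ [n _ <-]|y yx]; first by have [] := fP n.
have [n yn] := xP.2 y yx; exists n => //.
exact: has_rank_inj (fP n).2 yn.
Qed.

Variable a : degree.

Lemma iteration_rank s n x : iteration R Gamma (principal a) s ->
  has_rank n x -> s x = principal (iter n djump a).
Proof.
move=> sI; elim: n x => [|n IHn] x /=; first exact: iteration_zero sI x.
move=> [y yn xS]; rewrite (iteration_succ sI xS) (IHn _ yn).
by rewrite Gamma_principal.
Qed.

Lemma first_unranked_limit x : first_unranked x -> is_limit R x.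
Proof.
move=> xP; split; first by have [y yx _] := exists_rank_below _ 0 xP; exists y.
move=> y xS; have [n yn] := xP.2 _ (is_successor_below _ _ xS).
by apply: xP.1; exists n.+1, y.
Qed.

Lemma iteration_first_unranked s x : iteration R Gamma (principal a) s ->
  first_unranked x -> s x = Arith a.
Proof.
move=> sI xP; rewrite (iteration_limit sI (first_unranked_limit _ xP)).
apply/seteqP; split=> b.
- move=> [y yx]; have [n yn] := xP.2 _ yx.
  by rewrite (iteration_rank _ _ _ sI yn); exists n.
- move=> [n _ bn]; have [y yx yn] := exists_rank_below _ n xP.
  by exists y => //; rewrite (iteration_rank _ _ _ sI yn).
Qed.

(** No transfinite recursion is needed: [Gamma] fixes [Arith a], so the iteration can be constant at
    all points without finite rank. *)
Lemma exists_iteration : exists s, iteration R Gamma (principal a) s.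
Proof.
pose s (x : W) : set degree := [set b |
  (exists2 n, has_rank n x & principal (iter n djump a) b) \/
  (~ exists n, has_rank n x) /\ Arith a b].
have s_rank n x : has_rank n x -> s x = principal (iter n djump a).
  move=> xn; apply/seteqP; split=> b; last by left; exists n.
  move=> [[m xm]|[[]]]; last by exists n.
  by rewrite (has_rank_functional _ _ _ xn xm).
have s_unranked x : ~ (exists n, has_rank n x) -> s x = Arith a.
  move=> xN; apply/seteqP; split=> b; last by right.
  by move=> [[n xn]|[]//]; case: xN; exists n.
exists s; split.
- by move=> x x0; rewrite (s_rank 0).
- move=> x y xS; have [[n yn]|yN] := pselect (exists n, has_rank n y).
    by rewrite (s_rank n.+1 x) ?(s_rank n y) ?Gamma_principal //; exists y.
  rewrite (s_unranked y) // Gamma_Arith s_unranked // => -[n xn].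
  exact/yN/(has_rank_below _ _ _ xn)/is_successor_below.
- move=> x [x0 xl].
  have xN : ~ exists n, has_rank n x.
    move=> [[xn|n [y _ xS]]]; last exact: xl xS.
    by move: x0; rewrite xn => -[].
  (* The limit [x] may lie beyond omega, but the points of finite rank below [z] are also below [x]
     and already exhaust [Arith a]. *)
  rewrite s_unranked //; have [z [zP zx]] := exists_first_unranked _ xN.
  apply/seteqP; split=> b.
    move=> [n _ bn]; have [y yz yn] := exists_rank_below _ n zP.
    exists y; first exact: strictly_below_le zx yz.
    by rewrite (s_rank n).
  by move=> [y _ [[n _ bn]|[]//]]; exists n.
Qed.

(** A closure point has no finite rank, as those stages are not fixed; and no first unranked point
    lies strictly below it, as the stage there would be fixed too early. *)
Lemma closure_ordinalP x :
  is_closure_ordinal R Gamma (principal a) x <-> order_type_omega R x.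
Proof.
rewrite order_type_omegaP; split=> [[s [sI sx sN]]|xP].
  have [|z [zP zx]] := exists_first_unranked x.
    move=> [n xn]; move: sx; rewrite (iteration_rank _ _ _ sI xn).
    exact: principal_not_fixed.
  have [<-//|zNx] := pselect (z = x).
  by case: (sN z) => //; rewrite (iteration_first_unranked _ _ sI zP) Gamma_Arith.
have [s sI] := exists_iteration; exists s; split=> //.
  by rewrite (iteration_first_unranked _ _ sI xP) Gamma_Arith.
move=> y /(xP.2)[n yn]; rewrite (iteration_rank _ _ _ sI yn).
exact: principal_not_fixed.
Qed.

End WellOrder.

Theorem theorem3p3 (a : degree) :
  [/\ (forall n : nat,
         iter n Gamma (principal a) = principal (iter n djump a)),
      [/\ turing_ideal (Arith a),
          principal a `<=` Arith a,
          Gamma (Arith a) = Arith a &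
          forall J : set degree, turing_ideal J -> principal a `<=` J ->
            Gamma J = J -> Arith a `<=` J] &
      forall (W : Type) (R : rel W), well_order R -> forall alpha : W,
        is_closure_ordinal R Gamma (principal a) alpha <->
        order_type_omega R alpha].
Proof.
split; first exact: iter_Gamma_principal.
- split; first exact: Arith_ideal.
  + by move=> b ba; exists 0.
  + exact: Gamma_Arith.
  + by move=> J _; exact: Arith_least.
- by move=> W R wR x; exact: closure_ordinalP.
Qed.
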